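(* Let $N\ge2$ and let $\mathcal{U}\subseteq\{0,1,\dots,N-1\}^{\mathbb{Z}^2}$ be an additive shift space. Then $$h_r(\mathcal{U})=\sup\left\{h_\Omega(\mathcal{U}) : \Omega \text{ is a genuinely two-dimensional approximation to }\mathbb{Z}^2\right\}.$$
   Context: Let $\mathcal{A}=\{0,1,\dots,N-1\}$ with $N\ge2$. An additive shift space $\mathcal{U}\subseteq\mathcal{A}^{\mathbb{Z}^2}$ is a subset that is closed (in the product topology) and invariant under all shifts $\sigma^{\mathbf{v}}$, $\mathbf{v}\in\mathbb{Z}^2$, where $(\sigma^{\mathbf{v}}(x))_{i,j}=x_{(i,j)+\mathbf{v}}$. For finite $\mathbb{L}\subset\mathbb{Z}^2$, the interior is $\overset{\circ}{\mathbb{L}}=\{(i,j)\in\mathbb{L}: (i+1,j),(i,j+1),(i+1,j+1)\in\mathbb{L}\}$ and the boundary is $\partial\mathbb{L}=\mathbb{L}\setminus\overset{\circ}{\mathbb{L}}$. A genuinely two-dimensional approximation to $\mathbb{Z}^2$ is a sequence $\Omega=\{\Omega(n)\}_{n=1}^\infty$ of finite nonempty subsets of $\mathbb{Z}^2$ such that $\Omega(n)\subseteq\Omega(n+1)$ for all $n$, $\bigcup_{n\ge1}\Omega(n)=\mathbb{Z}^2$, and $\limsup_{n\to\infty}\frac{|\partial\Omega(n)|}{|\Omega(n)|}=0$. For finite $\mathbb{L}\subset\mathbb{Z}^2$ let $\Gamma(\mathbb{L},\mathcal{U})=|\{x|_{\mathbb{L}}: x\in\mathcal{U}\}|$, and $$h_\Omega(\mathcal{U})=\limsup_{n\to\infty}\frac{1}{|\Omega(n)|}\log\Gamma(\Omega(n),\mathcal{U}).$$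 Let $\mathbb{Z}_{m\times n}=\{(n_1,n_2):0\le n_1\le m-1,\ 0\le n_2\le n-1\}$. The rectangular entropy is $$h_r(\mathcal{U})=\limsup_{m,n\to\infty}\frac{1}{mn}\log\Gamma(\mathbb{Z}_{m\times n},\mathcal{U})$$ (the limit exists and equals $\inf_{m,n\ge1}\frac1{mn}\log\Gamma(\mathbb{Z}_{m\times n},\mathcal{U})$). *)

(* Defs.v *)
From HB Require Import structures.
From mathcomp Require Import all_boot all_order all_algebra finmap.
From mathcomp Require Import all_classical all_reals all_analysis.

Set Implicit Arguments.
Unset Strict Implicit.
Unset Printing Implicit Defensive.

Import Order.TTheory GRing.Theory Num.Theory.

Local Open Scope classical_set_scope.
Local Open Scope ring_scope.

Notation Z2 := (int * int)%type.

(* The product topology of the discrete topology on {0, .., N-1}. *)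
Notation config N := {ptws Z2 -> discrete_topology 'I_N}.

Definition shiftZ2 N (v : Z2) (x : config N) : config N :=
  fun u => x (u.1 + v.1, u.2 + v.2).

Definition additive_shift_space N (U : set (config N)) : Prop :=
  closed U /\ forall v : Z2, shiftZ2 v @` U = U.

Definition interior2 (L : {fset Z2}) : {fset Z2} :=
  [fset v in L | [&& (v.1 + 1, v.2)%R \in L, (v.1, v.2 + 1)%R \in L
                   & (v.1 + 1, v.2 + 1)%R \in L]]%fset.

Definition boundary2 (L : {fset Z2}) : {fset Z2} := (L `\` interior2 L)%fset.

(* A sequence (Omega(n))_{n >= 1} is represented with indices shifted by one:
   [Omega n] stands for Omega(n+1). *)
Definition genuine_approximation (R : realType) (Omega : nat -> {fset Z2}) :
    Prop :=
  [/\ forall n, Omega n != fset0,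
      forall n, (Omega n `<=` Omega n.+1)%fset,
      \bigcup_n [set` Omega n] = [set: Z2] &
      limn_esup (fun n =>
        (#|` boundary2 (Omega n)|%:R / #|` Omega n|%:R : R)%:E) = 0%E].

Definition restr N (L : {fset Z2}) (x : config N) : {ffun L -> 'I_N} :=
  [ffun v => x (val v)].

Definition Gamma N (L : {fset Z2}) (U : set (config N)) : nat :=
  #|[set p : {ffun L -> 'I_N} | p \in restr L @` U]%SET|.

(* [lne] is the extended logarithm, with [lne 0 = -oo]; this value occurs
   only when U is empty. *)
Definition log_density (R : realType) N (U : set (config N)) (L : {fset Z2}) :
    \bar R :=
  (((#|` L|%:R)^-1)%:E * lne ((Gamma L U)%:R)%:E)%E.

Definition h_approx (R : realType) N (U : set (config N))
    (Omega : nat -> {fset Z2}) : \bar R :=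
  limn_esup (fun n => log_density R U (Omega n)).

Definition rect (m n : nat) : {fset Z2} :=
  [fset (i%:Z, j%:Z) | i in iota 0 m, j in iota 0 n]%fset.

(* [limf_esup] along the product filter: m and n tend to infinity
   independently. *)
Definition h_rect (R : realType) N (U : set (config N)) : \bar R :=
  limf_esup
    (fun mn : nat * nat =>
       (((mn.1 * mn.2)%N%:R^-1)%:E * lne ((Gamma (rect mn.1 mn.2) U)%:R)%:E)%E)
    (filter_prod \oo \oo).

(* Main.v *)
(** The heart of the proof is the estimate, valid for all finite nonempty [L]
    and all [p, q > 0],
      log Gamma(L) / |L|
        <= log Gamma(rect p q) / (p q) + p q log N |boundary L| / |L|.
    A point of [L] at which a [p] by [q] rectangle does not fit into [L] is
    within reach of a boundary point, so at most [p q |boundary L|] points are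
    of this kind. The others split into [p q] residue classes, and one of
    these classes gives disjoint rectangles in [L] that leave at most
    [p q |boundary L|] points uncovered.
    If the boundary ratio tends to zero, the upper limit of the left-hand side
    is at most the density of every [rect p q]. For the sets of a genuine
    approximation this bounds its entropy by [h_rect]; for large rectangles it
    bounds [h_rect] by the density of every square, hence by the entropy along
    centered squares. *)

Require Import Defs.
From HB Require Import structures.
From mathcomp Require Import all_boot all_order all_algebra finmap.
From mathcomp Require Import all_classical all_reals all_analysis.
From mathcomp Require Import zify ring lra.

Set Implicit Arguments.
Unset Strict Implicit.
Unset Printing Implicit Defensive.

Import Order.TTheory GRing.Theory Num.Theory.

Local Open Scope classical_set_scope.
Local Open Scope fset_scope.
Local Open Scope ring_scope.

(** * Counting patterns of a shift space *)

Section PatternCounting.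
Variables (N : nat) (U : set (config N)).

(** Choose a point of [U] above each pattern on [L]; by the second hypothesis [g] separates the
    chosen points. [Gamma_expn], [GammaU] and [Gamma_translate] are all instances. *)
Lemma Gamma_leq_card (T : finType) (L : {fset Z2}) (g : config N -> T)
    (A : {pred T}) :
  (forall x, U x -> g x \in A) ->
  (forall x y, U x -> U y -> g x = g y -> restr L x = restr L y) ->
  (Gamma L U <= #|A|)%N.
Proof.
move=> gA gL.
set P := [set p : {ffun L -> 'I_N} | p \in (restr L @` U)%classic]%SET.
have preP p : p \in P -> exists2 x, U x & restr L x = p.
  by rewrite finset.inE => /set_mem.
have [P0|[p0 p0P]] := finset.set_0Vmem P.
  by rewrite /Gamma -/P P0 finset.cards0.
have [x0 Ux0 _] := preP _ p0P.
pose c p := xget x0 [set x | U x /\ restr L x = p].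
have cP p : p \in P -> U (c p) /\ restr L (c p) = p.
  move=> /preP[x Ux xp]; have : [set x | U x /\ restr L x = p] x by [].
  exact: xgetI.
rewrite /Gamma -/P -(@card_in_imset _ _ (g \o c) P).
  apply/subset_leq_card/fintype.subsetP => _ /imsetP[p /cP[Up _] ->] /=.
  exact: gA.
move=> p q /cP[Up cp] /cP[Uq cq] /= cpq.
by rewrite -cp -cq; exact: gL.
Qed.

Lemma restr_mem (L : {fset Z2}) x : U x ->
  restr L x \in [set p : {ffun L -> 'I_N} | p \in (restr L @` U)%classic]%SET.
Proof. by move=> Ux; rewrite finset.inE; apply/mem_set; exists x. Qed.

Lemma restr_eqP (L : {fset Z2}) (x y : config N) :
  restr L x = restr L y <-> {in L, x =1 y}.
Proof.
split=> [/ffunP e v vL|e].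
  by have := e [` vL]; rewrite !ffunE.
by apply/ffunP => v; rewrite !ffunE e ?fsvalP.
Qed.

Lemma Gamma_expn (L : {fset Z2}) : (Gamma L U <= N ^ #|` L|)%N.
Proof.
rewrite cardfE -[X in (X ^ _)%N]card_ord -card_ffun.
exact: (@Gamma_leq_card _ _ (restr L)).
Qed.

Lemma GammaU (A B : {fset Z2}) :
  (Gamma (A `|` B) U <= Gamma A U * Gamma B U)%N.
Proof.
rewrite /Gamma -finset.cardsX.
apply: (@Gamma_leq_card _ _ (fun x => (restr A x, restr B x))).
  by move=> x Ux; rewrite finset.in_setX !restr_mem.
move=> x y _ _ [/restr_eqP eA /restr_eqP eB]; apply/restr_eqP => v.
by rewrite in_fsetU => /orP[/eA|/eB].
Qed.

Lemma Gamma_gt0 (L : {fset Z2}) : U !=set0 -> (0 < Gamma L U)%N.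
Proof.
by case=> x Ux; apply/card_gt0P; exists (restr L x); exact: restr_mem.
Qed.

Definition translate (v : Z2) (L : {fset Z2}) : {fset Z2} :=
  [fset v + u | u in L].

Lemma mem_translate v (L : {fset Z2}) w : (w \in translate v L) = (w - v \in L).
Proof.
apply/imfsetP/idP => [[u /= uL ->]|wL]; first by rewrite addrC addKr.
by exists (w - v) => //; rewrite addrC subrK.
Qed.

Lemma card_translate v (L : {fset Z2}) : #|` translate v L| = #|` L|.
Proof. by rewrite card_imfset //; exact: addrI. Qed.

Lemma translateK v : cancel (translate v) (translate (- v)).
Proof.
by move=> L; apply/fsetP => w; rewrite !mem_translate opprK addrK.
Qed.

Hypothesis hU : additive_shift_space U.

Lemma shift_mem v x : U x -> U (shiftZ2 v x).
Proof. by move=> Ux; rewrite -(hU.2 v); exists x. Qed.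

Lemma Gamma_translate v (L : {fset Z2}) :
  Gamma (translate v L) U = Gamma L U.
Proof.
have le w (K : {fset Z2}) : (Gamma (translate w K) U <= Gamma K U)%N.
  apply: (@Gamma_leq_card _ _ (fun x => restr K (shiftZ2 w x))).
    by move=> x Ux; exact/restr_mem/shift_mem.
  move=> x y _ _ /restr_eqP e; apply/restr_eqP => u.
  rewrite mem_translate => /e.
  have E z : shiftZ2 w z (u - w) = z u by congr z; exact: (@subrK Z2 w u).
  by rewrite !E.
(* The reverse inequality is [le] for the translation by [- v]. *)
by apply/eqP; rewrite eqn_leq le /= -{1}(translateK v L) le.
Qed.

(** Induction on [s]: splitting off a tile costs a factor [Gamma T U] by translation invariance, and
    each point left over at the end costs at most a factor [N]. The size bound later limits the
    number of tiles. *)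
Lemma Gamma_tiles (T : {fset Z2}) (s : seq Z2) (L : {fset Z2}) :
  {in s, forall v, translate v T `<=` L} ->
  pairwise (fun v w => [disjoint translate v T & translate w T]) s ->
  (size s * #|` T| <= #|` L|)%N /\
  (Gamma L U <= Gamma T U ^ size s * N ^ (#|` L| - size s * #|` T|))%N.
Proof.
elim: s L => [|v s IH] L sL /=; first by rewrite subn0 mul1n Gamma_expn.
move=> /andP[/allP dv ds].
have vL : translate v T `<=` L by apply: sL; rewrite mem_head.
have sL' : {in s, forall w, translate w T `<=` L `\` translate v T}.
  move=> w ws; rewrite fsubsetD sL ?in_cons ?ws ?orbT//= fdisjoint_sym.
  exact: dv.
have [cL' GL'] := IH _ sL' ds.
rewrite cardfsDS // card_translate in cL' GL'.
have cL : (#|` T| <= #|` L|)%N by rewrite -(card_translate v) fsubset_leq_card.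
split; first by rewrite mulSn -leq_subRL.
rewrite -[in Gamma L U](fsetID (translate v T) L) (fsetIidPr vL).
rewrite mulSn subnDA expnS -mulnA.
apply: leq_trans (GammaU _ _) _.
by rewrite Gamma_translate leq_mul2l GL' orbT.
Qed.

End PatternCounting.

(** * Rectangles that fit into a finite set *)

Lemma mem_rect (p q : nat) (w : Z2) :
  (w \in rect p q) = [&& 0 <= w.1, w.1 < p%:Z, 0 <= w.2 & w.2 < q%:Z].
Proof.
apply/idP/idP => [/imfset2P[i /= + [j /= + ->]]|].
  by rewrite !mem_iota /=; lia.
case: w => -[i|i] [j|j] /and4P[] //= _ ip _ jq; apply/imfset2P.
exists i; first by rewrite /= mem_iota; lia.
by exists j => //; rewrite /= mem_iota; lia.
Qed.

Lemma card_rect (p q : nat) : #|` rect p q| = (p * q)%N.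
Proof.
pose s : seq Z2 := [seq (i%:Z, j%:Z) | i <- iota 0 p, j <- iota 0 q].
have us : uniq s.
  by apply: allpairs_uniq; rewrite ?iota_uniq// => -[? ?] [? ?] _ _ /= [-> ->].
have -> : rect p q = seq_fset tt s.
  apply/fsetP => w; rewrite seq_fsetE.
  apply/imfset2P/allpairsP => [[i /= ip [j /= jq ->]]|[[i j] /= [ip jq ->]]].
    by exists (i, j).
  by exists i => //; exists j.
by rewrite size_seq_fset undup_id // size_allpairs !size_iota.
Qed.

Lemma mem_interior2 (L : {fset Z2}) (v : Z2) :
  (v \in interior2 L) = [&& v \in L, v + (1, 0) \in L, v + (0, 1) \in L
                          & v + (1, 1) \in L].
Proof.
case: v => a b; rewrite /interior2 !inE /=.
have -> : (a, b) + (1, 0) = (a + 1, b) :> Z2 by congr pair; rewrite /= addr0.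
by have -> : (a, b) + (0, 1) = (a, b + 1) :> Z2 by congr pair; rewrite /= addr0.
Qed.

Lemma interior2_step (L : {fset Z2}) (v : Z2) :
  v \in L -> v \notin boundary2 L -> v + (1, 0) \in L /\ v + (0, 1) \in L.
Proof.
move=> vL; rewrite /boundary2 in_fsetD vL andbT negbK mem_interior2.
by case/and4P.
Qed.

(* Walking from [v] rightwards, then upwards, one cannot leave [L] without
   meeting its boundary. *)
Lemma translate_rect_subset (L : {fset Z2}) (v : Z2) (p q : nat) :
  v \in L -> {in rect p q, forall u, v + u \notin boundary2 L} ->
  translate v (rect p q) `<=` L.
Proof.
move=> vL vR.
have row (i : nat) : (0 < q)%N -> (i < p)%N -> v + (i%:Z, 0) \in L.
  move=> q0; elim: i => [|i IH] ip; first by rewrite addr0.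
  have [|+ _] := @interior2_step L (v + (i%:Z, 0)) (IH (ltnW ip)).
    by apply: vR; rewrite mem_rect /=; lia.
  have -> : (i.+1%:Z, 0) = (i%:Z, 0) + (1, 0) :> Z2 by congr pair => /=; lia.
  by rewrite addrA.
have col (i j : nat) : (i < p)%N -> (j < q)%N -> v + (i%:Z, j%:Z) \in L.
  move=> ip; elim: j => [|j IH] jq; first exact: row.
  have [|_ +] := @interior2_step L (v + (i%:Z, j%:Z)) (IH (ltnW jq)).
    by apply: vR; rewrite mem_rect /=; lia.
  have -> : (i%:Z, j.+1%:Z) = (i%:Z, j%:Z) + (0, 1) :> Z2.
    by congr pair => /=; lia.
  by rewrite addrA.
apply/fsubsetP => w /imfsetP[u /= /imfset2P[i /= + [j /= + ->]] ->].
by rewrite !mem_iota; exact: col.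
Qed.

Definition inner_corners (p q : nat) (L : {fset Z2}) : {fset Z2} :=
  [fset v in L | translate v (rect p q) `<=` L].

Lemma card_inner_corners (p q : nat) (L : {fset Z2}) :
  (#|` L| <= #|` inner_corners p q L| + p * q * #|` boundary2 L|)%N.
Proof.
have VL : inner_corners p q L `<=` L.
  by apply/fsubsetP => v; rewrite !inE => /andP[].
rewrite -leq_subLR -cardfsDS // -(card_rect p q) mulnC
  -(size_allpairs (fun b u : Z2 => b - u)).
apply: uniq_leq_size (fset_uniq _) _ => v.
rewrite in_fsetD !inE => /andP[+ vL]; rewrite vL /= => vV.
have [/hasP[u uR vu]|no] :=
  boolP (has (fun u => v + u \in boundary2 L) (rect p q)).
  by apply/allpairsP; exists (v + u, u); split=> //=; rewrite addrK.
exfalso; move/negP: vV; apply; apply: translate_rect_subset vL _ => u uR.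
by apply: contra no => vu; apply/hasP; exists u.
Qed.

Lemma modz_tile_eq (p : nat) (a b i j : int) :
  (a %% p)%Z = (b %% p)%Z -> 0 <= i -> i < p%:Z -> 0 <= j -> j < p%:Z ->
  a + i = b + j -> i = j.
Proof.
move=> ab i0 ip j0 jp e.
have : (i = j %[mod p])%Z.
  apply/eqP; rewrite -(eqz_modDl a) e eqz_modDr; exact/eqP.
by rewrite !modz_small ?i0 ?j0.
Qed.

(** * Disjoint tiles from residue classes *)

Section ResidueClasses.
Variables (p q : nat) (p0 : (0 < p)%N) (q0 : (0 < q)%N).

Definition residue_class (v : Z2) : Z2 := ((v.1 %% p)%Z, (v.2 %% q)%Z).

Lemma residue_class_rect v : residue_class v \in rect p q.
Proof.
rewrite mem_rect /= !modz_ge0 ?ltz_pmod //; lia.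
Qed.

(** The offsets of a common point from the two corners are congruent and lie in the same rectangle,
    so they agree, and the corners coincide. *)
Lemma disjoint_tiles v w : residue_class v = residue_class w -> v != w ->
  [disjoint translate v (rect p q) & translate w (rect p q)]%fset.
Proof.
move=> [vw1 vw2] /eqP vw; apply/fdisjointP => z zv; apply/negP => zw.
apply: vw; move: zv zw; rewrite !mem_translate !mem_rect.
case: v w z vw1 vw2 => [v1 v2] [w1 w2] [z1 z2] /= vw1 vw2.
move=> /and4P[? ? ? ?] /and4P[? ? ? ?].
have e1 : z1 - v1 = z1 - w1.
  by apply: (modz_tile_eq vw1) => //; lia.
have e2 : z2 - v2 = z2 - w2.
  by apply: (modz_tile_eq vw2) => //; lia.
by congr pair; lia.
Qed.

(** Pigeonhole: otherwise each of the [p * q] classes contributes at most [#|] V| -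
    1[after multiplication by]p * q[, and the sum falls short of]#|[V| * (p * q)]. *)
Lemma large_residue_class (V : {fset Z2}) :
  exists c, (#|` V| <= #|` [fset v in V | residue_class v == c]| * (p * q))%N.
Proof.
pose Vc c := [fset v in V | residue_class v == c].
apply: contrapT => /forallNP small.
have {}small c : (#|` Vc c| * (p * q) < #|` V|)%N.
  by rewrite ltnNge; apply/negP; exact: small.
have VT : (#|` V| <= \sum_(c <- rect p q) #|` Vc c|)%N.
  have -> : (\sum_(c <- rect p q) #|` Vc c|)%N =
      size (flatten [seq enum_fset (Vc c) | c <- rect p q]).
    by rewrite size_flatten sumnE /shape -map_comp big_map.
  apply: uniq_leq_size (fset_uniq _) _ => v vV; apply/flatten_mapP.
  by exists (residue_class v); rewrite ?residue_class_rect // !inE vV eqxx.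
have : (#|` V| * (p * q) <= \sum_(c <- rect p q) #|` V|.-1)%N.
  apply: leq_trans (leq_mul VT (leqnn _)) _; rewrite big_distrl /=.
  by apply: leq_sum => c _; rewrite -ltnS (ltn_predK (small c)) small.
rewrite big_const_seq count_predT iter_addn_0 card_rect.
rewrite leq_pmul2r ?muln_gt0 ?p0 // leqNgt ltn_predL.
(* The bound for the class of 0 shows that [V] is nonempty, so its predecessor is strictly
   smaller. *)
by rewrite (leq_ltn_trans _ (small 0)).
Qed.

End ResidueClasses.

Lemma Gamma_le_tiling (N : nat) (U : set (config N)) (p q : nat)
    (L : {fset Z2}) :
  (0 < N)%N -> (0 < p)%N -> (0 < q)%N -> additive_shift_space U ->
  exists2 k, (k * (p * q) <= #|` L|)%N &
    (Gamma L U <= Gamma (rect p q) U ^ k * N ^ (p * q * #|` boundary2 L|))%N.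
Proof.
move=> N0 p0 q0 hU; set V := inner_corners p q L.
have [c Vc] := large_residue_class p0 q0 V.
set W := [fset v in V | residue_class p q v == c] in Vc.
have WP v : v \in W -> translate v (rect p q) `<=` L /\ residue_class p q v = c.
  by rewrite !inE => /andP[/andP[_ ->] /eqP].
have [||cL GL] := @Gamma_tiles _ U hU (rect p q) W L.
- by move=> v /WP[].
- have: uniq W by exact: fset_uniq.
  rewrite uniq_pairwise; apply: (@sub_in_pairwise _ (mem W)); last exact/allP.
  by move=> v w /WP[_ vc] /WP[_ wc]; apply: disjoint_tiles; rewrite ?vc.
rewrite card_rect in cL GL; exists #|` W| => //.
apply: leq_trans GL _; rewrite leq_mul2l leq_pexp2l ?orbT // leq_subLR.
by apply: leq_trans (card_inner_corners p q L) _; rewrite leq_add2r.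
Qed.

(** * The density estimate and its upper limit *)

Section EntropyDensity.
Variables (R : realType) (N : nat) (U : set (config N)).
Hypothesis N2 : (2 <= N)%N.
Hypothesis hU : additive_shift_space U.

Let ratio (L : {fset Z2}) : R := #|` boundary2 L|%:R / #|` L|%:R.

Lemma log_density_ln (L : {fset Z2}) : U !=set0 ->
  log_density R U L = (#|` L|%:R^-1 * ln (Gamma L U)%:R)%:E.
Proof. by move=> U0; rewrite /log_density lne_EFin ?ltr0n ?Gamma_gt0. Qed.

Lemma log_density_set0 (L : {fset Z2}) : L != fset0 ->
  log_density R (set0 : set (config N)) L = -oo%E.
Proof.
move=> L0; rewrite /log_density /Gamma.
have -> : [set p : {ffun L -> 'I_N} | p \in (restr L @` set0)%classic]%SET
    = finset.set0.
  by apply/setP => p; rewrite !finset.inE image_set0 in_set0.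
rewrite finset.cards0 le0_lneNy // mulrNy gtr0_sg ?mul1e //.
by rewrite invr_gt0 ltr0n cardfs_gt0.
Qed.

Lemma log_density_tiling (p q : nat) (L : {fset Z2}) :
  (0 < p)%N -> (0 < q)%N -> L != fset0 ->
  (log_density R U L <= log_density R U (rect p q) +
    ((p * q)%:R * ln N%:R * ratio L)%:E)%E.
Proof.
move=> p0 q0 L0.
(* For empty [U] the left-hand side is [-oo]; otherwise all terms are finite. *)
have [->|/set0P U0] := eqVneq U set0.
  by rewrite (log_density_set0 L0) leNye.
rewrite !log_density_ln // card_rect -EFinD lee_fin.
have N0 : (0 < N)%N by exact: leq_trans N2.
have [k kL GL] := Gamma_le_tiling L N0 p0 q0 hU.
set G := Gamma L U in GL *; set H := Gamma (rect p q) U in GL *.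
set b := #|` boundary2 L| in GL *.
have G0 : (0 < G)%N by exact: Gamma_gt0.
have H0 : (0 < H)%N by exact: Gamma_gt0.
have lnG : ln (G%:R : R) <= k%:R * ln H%:R + (p * q)%:R * b%:R * ln N%:R.
  have -> : k%:R * ln H%:R + (p * q)%:R * b%:R * ln N%:R
      = ln ((H ^ k * N ^ (p * q * b))%:R : R).
    rewrite (natrM _ (H ^ k)) !natrX lnM ?posrE ?exprn_gt0 ?ltr0n //.
    rewrite !lnXn ?ltr0n //.
    by rewrite mulr_natl -natrM mulr_natl.
  by rewrite ler_ln ?posrE ?ltr0n ?muln_gt0 ?expn_gt0 ?H0 ?N0 // ler_nat.
have L1 : 0 < #|` L|%:R :> R by rewrite ltr0n cardfs_gt0.
have pq1 : 0 < (p * q)%:R :> R by rewrite ltr0n muln_gt0 p0.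
have kL1 : k%:R <= #|` L|%:R / (p * q)%:R :> R.
  by rewrite ler_pdivlMr // -natrM ler_nat.
have lnH : 0 <= ln (H%:R : R) by rewrite ln_ge0 // ler1n.
rewrite mulrC ler_pdivrMr // mulrDl.
apply: le_trans lnG _; rewrite /ratio -/b.
apply: lerD; last by rewrite -!mulrA mulVf ?gt_eqF // mulr1 (mulrC (ln _)).
by apply: le_trans (ler_wpM2r lnH kL1) _; rewrite mulrC mulrA mulrC mulrA.
Qed.

(** The family [F] is left general to serve both sequences and rectangles with independently growing
    sides. *)
Lemma limf_esup_log_density_le (T : choiceType) (X : filteredType T)
    (F : set_system X) (Om : X -> {fset Z2}) (p q : nat) :
  (0 < p)%N -> (0 < q)%N ->
  (forall d : R, 0 < d -> F [set x | Om x != fset0 /\ ratio (Om x) < d]) ->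
  (limf_esup (fun x => log_density R U (Om x)) F
     <= log_density R U (rect p q))%E.
Proof.
move=> p0 q0 FOm; apply/lee_addgt0Pr => e e0.
set C : R := (p * q)%:R * ln N%:R.
have C0 : 0 < C by rewrite mulr_gt0 ?ln_gt0 ?ltr1n // ltr0n muln_gt0 p0.
apply: ge_ereal_inf; eexists.
  (* The threshold [e / C] makes the error term [C * ratio] smaller than [e]. *)
  by exists [set x | Om x != fset0 /\ ratio (Om x) < e / C];
    first exact/FOm/divr_gt0.
apply: ge_ereal_sup => _ [x [x0 xe] <-].
apply: le_trans (log_density_tiling p0 q0 x0) _.
by rewrite leeD2l // lee_fin mulrC -ler_pdivlMr // ltW.
Qed.

End EntropyDensity.

(** * Boundaries of rectangles and centered squares *)

Lemma boundary2_translate (v : Z2) (L : {fset Z2}) :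
  boundary2 (translate v L) = translate v (boundary2 L).
Proof.
apply/fsetP => w; rewrite mem_translate /boundary2 !in_fsetD !mem_interior2.
by rewrite !mem_translate !(addrAC w _ (- v)).
Qed.

Lemma card_boundary2_rect (m n : nat) : (#|` boundary2 (rect m n)| <= m + n)%N.
Proof.
have sub : interior2 (rect m n) `<=` rect m n.
  by apply/fsubsetP => v; rewrite mem_interior2 => /and4P[].
(* Deleting the last row and the last column leaves only interior points. *)
have : (m.-1 * n.-1 <= #|` interior2 (rect m n)|)%N.
  rewrite -card_rect; apply/fsubset_leq_card/fsubsetP => -[a b].
  by rewrite mem_interior2 !mem_rect /=; lia.
rewrite /boundary2 cardfsDS // card_rect.
by case: m n {sub} => [|m] [|n] /=; lia.
Qed.

(** Positivity is recorded because [0^-1 = 0] also satisfies the bound. *)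
Lemma near_invn_lt (R : realType) (e : R) : 0 < e ->
  \forall n \near \oo, (0 < n)%N /\ n%:R^-1 < e.
Proof.
move=> e0; have [M _ HM] := near_infty_natSinv_lt (PosNum e0).
by exists M.+1 => // -[|n] //= Mn; split=> //; exact: HM.
Qed.

Lemma boundary2_rect_ratio (R : realType) (v : Z2) (m n : nat) :
  (0 < m)%N -> (0 < n)%N ->
  #|` boundary2 (translate v (rect m n))|%:R / #|` translate v (rect m n)|%:R
    <= m%:R^-1 + n%:R^-1 :> R.
Proof.
move=> m0 n0; rewrite boundary2_translate !card_translate card_rect.
have m1 : m%:R != 0 :> R by rewrite pnatr_eq0 -lt0n.
have n1 : n%:R != 0 :> R by rewrite pnatr_eq0 -lt0n.
have -> : m%:R^-1 + n%:R^-1 = (m + n)%:R / (m * n)%:R :> R.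
  by rewrite natrD natrM; field; rewrite m1 n1.
by rewrite ler_wpM2r ?invr_ge0 ?ler0n // ler_nat card_boundary2_rect.
Qed.

(** The square from [-n] to [n] in both coordinates; squares with a corner at the origin would
    exhaust only a quadrant. *)
Definition centered_square (n : nat) : {fset Z2} :=
  translate (- n%:Z, - n%:Z) (rect (n.*2.+1) (n.*2.+1)).

Lemma mem_centered_square n (w : Z2) :
  (w \in centered_square n) = (`|w.1| <= n)%N && (`|w.2| <= n)%N.
Proof. by rewrite mem_translate mem_rect /=; lia. Qed.

Lemma rect_neq0 m n : (0 < m)%N -> (0 < n)%N -> rect m n != fset0.
Proof. by move=> m0 n0; rewrite -cardfs_gt0 card_rect muln_gt0 m0. Qed.

Lemma genuine_centered_square (R : realType) :
  genuine_approximation R centered_square.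
Proof.
split.
- by move=> n; rewrite -cardfs_gt0 card_translate card_rect.
- move=> n; apply/fsubsetP => w; rewrite !mem_centered_square.
  by move=> /andP[w1 w2]; rewrite !leqW.
- apply/seteqP; split=> // w _; exists (`|w.1| + `|w.2|)%N => //=.
  by rewrite mem_centered_square leq_addr leq_addl.
- apply/eqP; rewrite eq_le; apply/andP; split; last first.
    apply: limf_esup_ge0; last by move=> n; rewrite lee_fin divr_ge0.
    exact: filter_not_empty.
  apply/lee_addgt0Pr => e e0; rewrite add0e.
  apply: ge_ereal_inf; eexists.
    (* Each of the two sides contributes at most [1 / (2n + 1) <= 1 / n] to the ratio. *)
    by exists [set n : nat | (0 < n)%N /\ n%:R^-1 < e / 2 :> R];
      first exact/near_invn_lt/divr_gt0.
  apply: ge_ereal_sup => _ [n [n0 ne] <-]; rewrite lee_fin.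
  apply: le_trans (boundary2_rect_ratio _ _ _ _) _ => //.
  have : (n.*2.+1)%:R^-1 <= n%:R^-1 :> R.
    by rewrite lef_pV2 ?posrE ?ltr0n // ler_nat; lia.
  move=> /le_lt_trans/(_ ne)/ltW ne'.
  by rewrite [leRHS]splitr lerD.
Qed.

(** * Comparison of the two entropies *)

Lemma limf_esup_ge (T : choiceType) (X : filteredType T) (R : realType)
    (F : set_system X) (f : X -> \bar R) (c : \bar R) :
  ProperFilter F -> (\forall x \near F, (c <= f x)%E) -> (c <= limf_esup f F)%E.
Proof.
move=> FF cf; apply: le_ereal_inf_tmp => _ [A FA <-].
have [x [Ax cx]] := filter_ex (filterI FA cf).
by apply: le_ereal_sup_tmp; exists (f x) => //; exists x.
Qed.

Lemma h_rectE (R : realType) (N : nat) (U : set (config N)) :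
  h_rect R U =
  limf_esup (fun mn : nat * nat => log_density R U (rect mn.1 mn.2))
            (filter_prod \oo \oo).
Proof.
rewrite /h_rect; congr limf_esup; apply/funext => -[m n].
by rewrite /log_density card_rect.
Qed.

Section RectangularEntropy.
Variables (R : realType) (N : nat) (U : set (config N)).
Hypothesis N2 : (2 <= N)%N.
Hypothesis hU : additive_shift_space U.

Lemma h_rect_le_log_density (p q : nat) : (0 < p)%N -> (0 < q)%N ->
  (h_rect R U <= log_density R U (rect p q))%E.
Proof.
move=> p0 q0; rewrite h_rectE; apply: limf_esup_log_density_le => // d d0.
pose A := [set n : nat | (0 < n)%N /\ n%:R^-1 < d / 2 :> R].
have FA : \oo A by exact/near_invn_lt/divr_gt0.
exists (A, A) => // -[m n] [/= [m0 md] [n0 nd]]; split; first exact: rect_neq0.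
have := boundary2_rect_ratio R 0 m0 n0.
have -> : translate 0 (rect m n) = rect m n.
  by apply/fsetP => w; rewrite mem_translate subr0.
lra.
Qed.

Lemma h_approx_le_log_density (Omega : nat -> {fset Z2}) (p q : nat) :
  (0 < p)%N -> (0 < q)%N -> genuine_approximation R Omega ->
  (h_approx R U Omega <= log_density R U (rect p q))%E.
Proof.
move=> p0 q0 [Om0 _ _ Omlim]; apply: limf_esup_log_density_le => // d d0.
have : (limn_esup (fun n =>
    (#|` boundary2 (Omega n)|%:R / #|` Omega n|%:R : R)%:E) < d%:E)%E.
  by rewrite Omlim lte_fin.
(* The upper limit is an infimum of suprema, so one of these suprema is already below [d]. *)
case/ereal_inf_lt => _ [A FA <-] Ad; apply: filterS FA => n An; split => //.
by rewrite -lte_fin; apply: le_lt_trans Ad; apply: ereal_sup_ubound; exists n.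
Qed.

Lemma h_approx_le_h_rect (Omega : nat -> {fset Z2}) :
  genuine_approximation R Omega -> (h_approx R U Omega <= h_rect R U)%E.
Proof.
move=> gO; rewrite h_rectE; apply: limf_esup_ge.
exists ([set n | (0 < n)%N], [set n | (0 < n)%N]).
  by split; exact: nbhs_infty_gt.
by move=> [m n] [/= m0 n0]; exact: h_approx_le_log_density.
Qed.

Lemma h_rect_le_h_centered_square :
  (h_rect R U <= h_approx R U centered_square)%E.
Proof.
apply: limf_esup_ge; near=> n.
(* By translation invariance the centered square has the density of a [rect]. *)
rewrite /log_density card_translate Gamma_translate //.
exact: h_rect_le_log_density.
Unshelve. all: by end_near. Qed.

End RectangularEntropy.

Theorem mainTheorem5 (R : realType) (N : nat) (hN : (2 <= N)%N)
    (U : set (config N)) (hU : additive_shift_space U) :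
  h_rect R U =
  ereal_sup [set h_approx R U Omega | Omega in @genuine_approximation R].
Proof.
apply/eqP; rewrite eq_le; apply/andP; split.
  (* The centered squares attain the supremum. *)
  apply: le_ereal_sup_tmp; exists (h_approx R U centered_square).
    by exists centered_square => //; exact: genuine_centered_square.
  exact: h_rect_le_h_centered_square.
apply: ge_ereal_sup => _ [Om gO <-]; exact: h_approx_le_h_rect.
Qed.
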